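(* Let $p(z)$ be a nonzero Hilbert polynomial of some graded quotient of $R=K[x_0,\ldots,x_n]$, let $a_0$ be the nonnegative integer associated to $p$, and let $\widetilde p(z)=p(z)-a_0$. Consider the procedure: compute the lexicographic ideal $L_{\widetilde p}\subset R$, and perform $a_0$ successive lex expansions of monomial generators starting from $L_{\widetilde p}$, exhausting all choices for $a_0$ successive lex expansions. The set of ideals obtained in this way is exactly the set of all almost lexsegment ideals $I\subset R$ such that $R/I$ has Hilbert polynomial $p(z)$.
   Context: $K$ is an arbitrary field, $n\ge2$, $R=K[x_0,\ldots,x_n]$, $R^{(1)}=K[x_0,\ldots,x_{n-1}]$. Monomials of the same degree are compared in the lexicographic order: $x^B>_{lex}x^C$ iff the first nonzero entry of $B-C$ is positive. A monomial ideal $I$ is strongly stable if for every monomial $x^A\in I$ and every $x_j\mid x^A$ we have $\frac{x_i}{x_j}x^A\in I$ whenever $0\le i<j$. A strongly stable ideal of $R$ is saturated iff no minimal monomial generator is divisible by $x_n$. $G(I)$ is the set of minimal monomial generators of $I$. A lexsegment ideal is a monomial ideal $I$ such that in each degree $j$, $[I]_j$ is spanned by the lexicographically first $\dim_K[I]_j$ monomials of degree $j$. A saturated strongly stable ideal $I\subset R$ is almost lexsegment if $I\cdot R^{(1)}$, the ideal of $R^{(1)}$ generated by $G(I)$, is a lexsegment ideal of $R^{(1)}$. Write $p(z)=\sum_{i=0}^{d}\left[\binom{z+i}{i+1}-\binom{z+i-b_i}{i+1}\right]$, $d=\deg p$, with the unique integers $b_0\ge\cdots\ge b_d>0$; $a_d=b_d$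 and $a_i=b_i-b_{i+1}$ for $0\le i<d$. For a Hilbert polynomial $q\ne 0$ of a graded quotient of $R$, the lexicographic ideal $L_q\subset R$ is the unique saturated lexsegment ideal of $R$ such that $R/L_q$ has Hilbert polynomial $q$; for $q=0$ put $L_0=R$. Expansion: for a monomial $x^A$ of positive degree put $\mathrm{Right}(x^A)=\{x^A\frac{x_{i+1}}{x_i}: x_i\mid x^A,\ 0\le i<n-1\}$. If $I\subsetneq R$ is saturated strongly stable and $1\ne x^A\in G(I)$ with $G(I)\cap\mathrm{Right}(x^A)=\varnothing$, then $x^A$ is expandable in $I$ and the expansion of $x^A$ in $I$ is the ideal generated by $(G(I)\setminus\{x^A\})\cup\{x^Ax_r,\ldots,x^Ax_{n-1}\}$, where $r=\max\{i:x_i\mid x^A\}$. The expansion of $1$ in $R$ is $(x_0,\ldots,x_{n-1})$. Lex expansion: for an almost lexsegment ideal $I$ and a degree in which $I$ has minimal generators, the expansion in $I$ of the lexicographically smallest minimal monomial generator of that degree (such a generator is always expandable; for $I=R$ it is the expansion of $1$). *)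

(* Defs.v *)
(* Ideals are handled as Prop-valued predicates on {mpoly K[n]}, equality of
   ideals being pointwise equivalence. In {mpoly K[n.+1]} = K[x_0,...,x_n] the
   variable x_n is 'X_ord_max, and {mpoly K[n]} = K[x_0,...,x_(n-1)] embeds
   through mwiden; mnmwiden extends an exponent vector by a last entry 0. *)
From HB Require Import structures.
From mathcomp Require Import all_boot all_order all_algebra.
From mathcomp Require Import mpoly.

Set Implicit Arguments.
Unset Strict Implicit.
Unset Printing Implicit Defensive.

Import Order.TTheory GRing.Theory Num.Theory.

Local Open Scope ring_scope.

Section Ideals.

Variables (K : fieldType) (n : nat).

Implicit Types (I J : {mpoly K[n]} -> Prop) (m : 'X_{1..n}) (f : {mpoly K[n]}).

Definition eq_ideal I J := forall f, I f <-> J f.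

Definition is_ideal I :=
  [/\ I 0, forall f g, I f -> I g -> I (f + g) & forall a f, I f -> I (a * f)].

Definition ideal_gen (S : {mpoly K[n]} -> Prop) : {mpoly K[n]} -> Prop :=
  fun f => exists (k : nat) (a s : 'I_k -> {mpoly K[n]}),
    (forall i, S (s i)) /\ f = \sum_(i < k) a i * s i.

Definition mono_ideal (S : 'X_{1..n} -> Prop) : {mpoly K[n]} -> Prop :=
  ideal_gen (fun f => exists2 m, S m & f = 'X_[m]).

Definition monomial_ideal I := exists S, eq_ideal I (mono_ideal S).

Definition homogeneous_ideal I :=
  is_ideal I /\ forall f d, I f -> I (pihomog mdeg d f).

(* I : (x_0,...,x_(n-1)) = I *)
Definition saturated I := forall f, (forall i : 'I_n, I ('X_i * f)) -> I f.

Definition strongly_stable I :=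
  monomial_ideal I /\
  forall m (i j : 'I_n), I 'X_[m] -> (0 < m j)%N -> (i < j)%N ->
    I 'X_[(m - U_(j) + U_(i))%MM].

(* G(I); (m' <= m)%MM is divisibility of monomials *)
Definition min_gen I m :=
  I 'X_[m] /\ forall m', I 'X_[m'] -> (m' <= m)%MM -> m' = m.

(* The monomials of degree d, lexicographically largest first: between
   monomials of equal degree the order %O of 'X_{1..n} is the lexicographic
   order with x_0 > x_1 > ... (see ltmcP). *)
Definition lex_monomials (d : nat) : seq 'X_{1..n} :=
  sort (fun m1 m2 => (m2 <= m1)%O)
    [seq m <- [seq bmnm t | t : 'X_{1..n < d.+1}] | mdeg m == d].

(* [I]_d is the K-span of the k lexicographically first monomials of degree d,
   i.e. consists of the forms supported on them; monomials being linearly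
   independent, k is dim_K [I]_d. *)
Definition lexsegment I :=
  monomial_ideal I /\
  forall d, exists2 k, (k <= size (lex_monomials d))%N &
    forall f, f \is d.-homog ->
      (I f <-> {subset msupp f <= take k (lex_monomials d)}).

End Ideals.

(* binom(q, k) as a polynomial in z, for q a polynomial in z *)
Definition binp (q : {poly rat}) (k : nat) : {poly rat} :=
  (k`!%:R)^-1 *: \prod_(j < k) (q - j%:R).

Definition is_bseq (p : {poly rat}) (b : nat -> nat) :=
  let d := (size p).-1 in
  [/\ forall i, (i < d)%N -> (b i.+1 <= b i)%N, (0 < b d)%N &
      p = \sum_(i < d.+1)
            (binp ('X + i%:R) i.+1 - binp ('X + i%:R - (b i)%:R) i.+1)].

Definition aseq (d : nat) (b : nat -> nat) (i : nat) : nat :=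
  if i == d then b d else (b i - b i.+1)%N.

Definition is_a0 (p : {poly rat}) (a0 : nat) :=
  exists2 b, is_bseq p b & a0 = aseq (size p).-1 b 0.

Section Expansions.

Variables (K : fieldType) (n : nat).

Implicit Types (I J L : {mpoly K[n.+1]} -> Prop) (m : 'X_{1..n.+1}).
Implicit Types (p q : {poly rat}).

Definition whole_ring : {mpoly K[n.+1]} -> Prop := fun=> True.

(* U is [I]_d as a subspace of [R]_d *)
Definition graded_part I d (U : {vspace dhomog n.+1 K d}) :=
  forall f : dhomog n.+1 K d, f \in U <-> I (mpoly_of_dhomog f).

Definition hilbert_poly I p :=
  exists N : nat, forall d, (N <= d)%N ->
    exists2 U, graded_part I (d := d) U &
      p.[d%:R] = (\dim {: dhomog n.+1 K d} - \dim U)%N%:R.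

(* The ideal of K[x_0,...,x_(n-1)] generated by G(I); for I saturated and
   strongly stable, no element of G(I) involves x_n. *)
Definition restr I : {mpoly K[n]} -> Prop :=
  mono_ideal (fun m : 'X_{1..n} => min_gen I (mnmwiden m)).

Definition almost_lex I :=
  [/\ strongly_stable I, saturated I & lexsegment (restr I)].

Definition lex_ideal q L :=
  if q == 0 then eq_ideal L whole_ring
  else [/\ saturated L, lexsegment L & hilbert_poly L q].

Definition Right m m' :=
  exists i j : 'I_n.+1,
    [/\ (i < n.-1)%N, j = i.+1 :> nat, (0 < m i)%N &
        m' = (m - U_(i) + U_(j))%MM].

Definition expandable I m :=
  [/\ strongly_stable I /\ saturated I, ~ eq_ideal I whole_ring, m <> 0%MM,
      min_gen I m & forall m', Right m m' -> ~ min_gen I m'].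

Definition max_var m : nat := \max_(i < n.+1 | (0 < m i)%N) i.

Definition expansion_gens I m : 'X_{1..n.+1} -> Prop := fun m' =>
  (min_gen I m' /\ m' <> m) \/
  exists k : 'I_n.+1, [/\ (max_var m <= k)%N, (k < n)%N & m' = (m + U_(k))%MM].

(* J is the expansion of m in I *)
Definition expansion I m J :=
  (expandable I m /\ eq_ideal J (mono_ideal (expansion_gens I m))) \/
  [/\ eq_ideal I whole_ring, m = 0%MM &
      eq_ideal J
        (mono_ideal (fun m' => exists2 k : 'I_n.+1, (k < n)%N & m' = U_(k)%MM))].

Definition lex_expansion I J :=
  almost_lex I /\
  exists m, [/\ min_gen I m,
    forall m', min_gen I m' -> mdeg m' = mdeg m -> (m <= m')%O &
    expansion I m J].

Inductive lex_expansions : nat -> ({mpoly K[n.+1]} -> Prop) ->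
    ({mpoly K[n.+1]} -> Prop) -> Prop :=
| lex_expansions0 I J : eq_ideal I J -> lex_expansions 0 I J
| lex_expansionsS k I J M :
    lex_expansion I J -> lex_expansions k J M -> lex_expansions k.+1 I M.

Definition obtained p (a0 : nat) I :=
  exists2 L, lex_ideal (p - a0%:R) L & lex_expansions a0 L I.

End Expansions.

(* Main.v *)
Require Import Defs.
From HB Require Import structures.
From mathcomp Require Import all_boot all_order all_algebra.
From mathcomp Require Import mpoly ring zify.
From Stdlib Require Import ClassicalEpsilon.

Set Implicit Arguments.
Unset Strict Implicit.
Unset Printing Implicit Defensive.

Import Order.TTheory GRing.Theory Num.Theory.
Import DefaultSeqLexiOrder.

Local Open Scope ring_scope.

(** A saturated strongly stable ideal is determined by its monomials free of
    [x_n], and these span a lexsegment ideal exactly when it is almost lexsegment.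
    A lex expansion of [m] removes precisely the monomials [m * x_n ^ c], so it
    keeps the ideal almost lexsegment and adds 1 to the Hilbert polynomial.

    Conversely, let [I <> 0] be almost lexsegment and let [e] be the
    lexicographically least exponent vector [(m_0, ..., m_(n-2))] of a monomial of
    [I].  The monomials whose first [n-1] exponents are at least [e] in the pure
    lexicographic order span a saturated lexsegment ideal [L] containing [I], and
    only finitely many monomials free of [x_n] lie in [L] but not in [I].  A lex
    expansion of [L] at a missing monomial of least degree stays above [I], so [I]
    is reached after finitely many steps, say [c].  Counting monomials one variable
    at a time, the Hilbert polynomial of [L] has [b_0 = b_1].  Adding [c] only
    changes [b_0] into [b_0 + c], and the b-sequence is unique, hence [c = a_0]. *)

(** * Monomial ideals and Hilbert functions *)

(** Ideals are [Prop]-valued; counting their monomials needs membership as a boolean, which is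
    supplied classically. *)
Definition asbool (P : Prop) : bool :=
  if excluded_middle_informative P then true else false.

Lemma asboolP (P : Prop) : reflect P (asbool P).
Proof. by rewrite /asbool; case: excluded_middle_informative => h; constructor. Qed.

(** If [a] fails at the head of the sorted list, it fails on the whole tail, since the head is
    related to every later element. *)
Lemma take_count_sorted (T : eqType) (r : rel T) (a : pred T) (s : seq T) :
    transitive r -> sorted r s ->
    {in s &, forall x y, r x y -> a y -> a x} ->
  take (count a s) s = filter a s.
Proof.
move=> rtr; elim: s => //= x s IH sxs aP.
have IHs : take (count a s) s = filter a s.
  apply: IH; first exact: path_sorted sxs.
  by move=> y z ys zs; apply: aP; rewrite inE ?ys ?zs orbT.
case: ifP => ax; first by rewrite add1n /= IHs.
have /eqP c0 : count a s == 0%N.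
  rewrite -leqn0 leqNgt -has_count; apply/hasPn => y ys; apply/negP => ay.
  have := allP (order_path_min rtr sxs) _ ys => rxy.
  by rewrite (aP x y) ?inE ?eqxx ?ys ?orbT in ax.
by rewrite c0 take0 -IHs c0 take0.
Qed.

Section Monomials.
Variable n : nat.
Implicit Types m : 'X_{1..n}.

Lemma mem_lex_monomials d m : (m \in lex_monomials n d) = (mdeg m == d).
Proof.
rewrite mem_sort mem_filter andbC; case: eqP => [dm|]; last by rewrite andbF.
rewrite andbT; apply/mapP.
have lt : (mdeg m < d.+1)%N by rewrite dm.
by exists (BMultinom lt) => //; rewrite mem_enum.
Qed.

Lemma lex_monomials_uniq d : uniq (lex_monomials n d).
Proof.
rewrite sort_uniq filter_uniq // map_inj_uniq ?enum_uniq //.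
exact: val_inj.
Qed.

Lemma lex_monomials_sorted d :
  sorted (fun m1 m2 => (m2 <= m1)%O) (lex_monomials n d).
Proof. by apply: sort_sorted => x y; rewrite orbC; apply: le_total. Qed.

Lemma lepm_mdeg m m' : (m <= m')%MM -> (mdeg m <= mdeg m')%N.
Proof. by move=> le; rewrite -(submK le) mdegD leq_addl. Qed.

Lemma lepm_mdeg_eq m m' : (m <= m')%MM -> mdeg m = mdeg m' -> m = m'.
Proof.
move=> le eqd; rewrite -(submK le).
have /eqP: mdeg (m' - m)%MM = 0%N.
  by have := mdegD (m' - m) m; rewrite (submK le) eqd; lia.
by rewrite mdeg_eq0 => /eqP ->; rewrite add0m.
Qed.

End Monomials.

Section MonomialIdeals.
Variables (K : fieldType) (n : nat).
Implicit Types (I J : {mpoly K[n]} -> Prop) (m : 'X_{1..n}) (f : {mpoly K[n]}).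

Lemma ideal_gen0 (S : {mpoly K[n]} -> Prop) : ideal_gen S 0.
Proof.
exists 0%N, (fun=> 0), (fun=> 0); split; first by case.
by rewrite big_ord0.
Qed.

Lemma ideal_genD (S : {mpoly K[n]} -> Prop) f g :
  ideal_gen S f -> ideal_gen S g -> ideal_gen S (f + g).
Proof.
case=> k [a [s [Ss ->]]] [l [b [t [St ->]]]].
pose glue (u : 'I_k -> {mpoly K[n]}) (v : 'I_l -> {mpoly K[n]}) i :=
  match split i with inl j => u j | inr j => v j end.
exists (k + l)%N, (glue a b), (glue s t); split.
  by move=> i; rewrite /glue; case: split.
rewrite big_split_ord /glue /=; congr (_ + _); apply: eq_bigr => i _.
  by rewrite (unsplitK (inl i)).
by rewrite (unsplitK (inr i)).
Qed.

(** Multiplying by ['X_[u]] shifts every exponent by [u]; conversely [f] is the sum of its terms,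
    each a multiple of one generator. *)
Lemma mono_idealP (S : 'X_{1..n} -> Prop) f :
  mono_ideal S f <->
  forall m, m \in msupp f -> exists2 s, S s & (s <= m)%MM.
Proof.
split=> [[k [a [s [Ss ->]]]]|fS].
  elim/big_ind: _ => [|g h IHg IHh m|i _ m].
  - by move=> m; rewrite msupp0.
  - by move/msuppD_le; rewrite mem_cat => /orP[/IHg|/IHh].
  case: (Ss i) => u Su ->; rewrite (perm_mem (msuppMX _ _)) => /mapP[v _ ->].
  by exists u => //; apply: lem_addr.
rewrite [f]mpolyE big_seq; elim/big_ind: _ => [|g h|m /fS[s Ss le_sm]].
- exact: ideal_gen0.
- exact: ideal_genD.
exists 1%N, (fun=> f@_m *: 'X_[m - s]), (fun=> 'X_[s]); split.
  by move=> _; exists s.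
by rewrite big_ord1 -scalerAl -mpolyXD submK.
Qed.

Lemma mono_idealX (S : 'X_{1..n} -> Prop) m :
  mono_ideal S ('X_[m] : {mpoly K[n]}) <-> exists2 s, S s & (s <= m)%MM.
Proof.
rewrite mono_idealP; split=> [h|h m'].
  by apply: h; rewrite msuppX inE.
by rewrite msuppX inE => /eqP ->.
Qed.

Lemma mono_ideal_monomial (S : 'X_{1..n} -> Prop) : monomial_ideal (mono_ideal (K := K) S).
Proof. by exists S. Qed.

Lemma monomial_idealP I f : monomial_ideal I ->
  I f <-> forall m, m \in msupp f -> I 'X_[m].
Proof.
case=> S IS; rewrite IS mono_idealP; split=> h m /h.
  by move=> h'; apply/IS/mono_idealX.
by move/IS/mono_idealX.
Qed.

Lemma monomial_ideal_upset I m m' : monomial_ideal I ->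
  I 'X_[m] -> (m <= m')%MM -> I 'X_[m'].
Proof.
case=> S IS /IS/mono_idealX[s Ss le_sm] le_m; apply/IS/mono_idealX.
by exists s => //; apply: lepm_trans le_m.
Qed.

Lemma monomial_idealDr I m m' : monomial_ideal I ->
  I 'X_[m] -> I 'X_[m + m'].
Proof. by move=> mI Im; apply: monomial_ideal_upset Im (lem_addr _ _). Qed.

Lemma eq_monomial_ideal I J : monomial_ideal I -> monomial_ideal J ->
  (forall m, I 'X_[m] <-> J 'X_[m]) -> eq_ideal I J.
Proof.
move=> mI mJ IJ f; rewrite (monomial_idealP f mI) (monomial_idealP f mJ).
by split=> h m /h /IJ.
Qed.

(** Meant for [A] closed under multiples: it is then the monomial ideal whose monomials are [A],
    with no generators to be chosen. *)
Definition supp_ideal (A : 'X_{1..n} -> Prop) : {mpoly K[n]} -> Prop :=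
  fun f => forall m, m \in msupp f -> A m.

Lemma supp_idealX (A : 'X_{1..n} -> Prop) m : supp_ideal A 'X_[m] <-> A m.
Proof.
split=> [|Am m']; first by apply; rewrite msuppX inE.
by rewrite msuppX inE => /eqP ->.
Qed.

Lemma supp_ideal_monomial (A : 'X_{1..n} -> Prop) :
    (forall m m', A m -> (m <= m')%MM -> A m') ->
  monomial_ideal (supp_ideal A).
Proof.
move=> Aup; exists A => f; rewrite mono_idealP; split=> h m /h.
  by move=> Am; exists m => //; apply: lepm_refl.
by case=> s As /(Aup _ _ As).
Qed.

Lemma eq_ideal_sym I J : eq_ideal I J -> eq_ideal J I.
Proof. by move=> h f; split=> /h. Qed.

Lemma monomial_ideal_eq I J : eq_ideal I J -> monomial_ideal I -> monomial_ideal J.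
Proof. by move=> IJ [S IS]; exists S => f; rewrite -IJ. Qed.

(** The list of monomials of a degree is sorted, so closure under lexicographically larger monomials
    means that those of [I] form an initial segment. This removes the dimension [k] from the
    definition. *)
Lemma lexsegmentP I : lexsegment I <->
  monomial_ideal I /\
  (forall m m', mdeg m = mdeg m' -> (m <= m')%O -> I 'X_[m] -> I 'X_[m']).
Proof.
split=> [[mI lI]|[mI lI]]; split=> //.
  move=> m m' dm le Im; have [k lek kP] := lI (mdeg m).
  have hX u : mdeg u = mdeg m ->
      I 'X_[u] <-> u \in take k (lex_monomials n (mdeg m)).
    move=> du; have hom : ('X_[u] : {mpoly K[n]}) \is (mdeg m).-homog.
      by rewrite dhomogX /= du.
    rewrite (kP _ hom); split; first by apply; rewrite msuppX inE.
    by move=> h v; rewrite msuppX inE => /eqP ->.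
  apply/(hX m') => //; move/(hX m (erefl _)): Im => Im.
  set s := lex_monomials n (mdeg m) in Im lek *.
  have ms' : m' \in s by rewrite mem_lex_monomials dm.
  rewrite -(cat_take_drop k s) mem_cat in ms'.
  case/orP: ms' => // m'd.
  have := lex_monomials_sorted n (mdeg m); rewrite -/s sorted_pairwise; last first.
    by move=> x y z h1 h2; apply: le_trans h2 h1.
  rewrite -{1}(cat_take_drop k s) pairwise_cat => /andP[/allrelP/(_ _ _ Im m'd)].
  by move=> le' _; have -> : m' = m by apply: le_anti; rewrite le le'.
move=> d; set s := lex_monomials n d.
exists (count (fun m => asbool (I 'X_[m])) s); first exact: count_size.
move=> f /dhomogP df.
rewrite (take_count_sorted (r := fun m1 m2 => (m2 <= m1)%O)); last 2 first.
- exact: lex_monomials_sorted.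
- move=> x y; rewrite !mem_lex_monomials => /eqP dx /eqP dy le_yx /asboolP Iy.
  by apply/asboolP; apply: lI Iy; rewrite // dx dy.
- rewrite (monomial_idealP f mI); split=> h m /[dup] mf /h.
    move=> Im; rewrite mem_filter; apply/andP; split; first exact/asboolP.
    by rewrite mem_lex_monomials; apply/eqP/df.
  by rewrite mem_filter => /andP[/asboolP].
by move=> x y z h1 h2; apply: le_trans h2 h1.
Qed.

Lemma min_gen_below I m : I 'X_[m] -> exists2 g, min_gen I g & (g <= m)%MM.
Proof.
have [d] := ubnP (mdeg m); elim: d m => // d IH m lt_md Im.
case: (asboolP (min_gen I m)) => [mg|nmg]; first by exists m => //; apply: lepm_refl.
have [m' [Im' le ne]] : exists m', [/\ I 'X_[m'], (m' <= m)%MM & m' <> m].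
  apply: NNPP => h; apply: nmg; split=> // m' Im' le.
  by apply: NNPP => ne; apply: h; exists m'.
have lt : (mdeg m' < mdeg m)%N.
  rewrite ltn_neqAle lepm_mdeg // andbT; apply/eqP => eqd.
  exact/ne/lepm_mdeg_eq.
have [|g mg le_g] := IH m' _ Im'; first lia.
by exists g => //; apply: lepm_trans le.
Qed.

End MonomialIdeals.

(** * Hilbert functions of monomial ideals as counts of monomials *)

Section HilbertFunction.
Variables (K : fieldType) (n : nat).
Implicit Types (I J : {mpoly K[n.+1]} -> Prop) (m : 'X_{1..n.+1}).

(** For a monomial ideal this is the Hilbert function of the quotient: the monomials outside [I]
    give a basis of it. *)
Definition nonmembers I d : nat :=
  count (fun m => ~~ asbool (I 'X_[m])) (lex_monomials n.+1 d).

(** The default [0] of [insubd] is never taken, since all listed monomials have degree [d]. *)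
Definition homog_monomials d (a : pred 'X_{1..n.+1}) : seq (dhomog n.+1 K d) :=
  [seq insubd (0 : dhomog n.+1 K d) 'X_[m] | m <- filter a (lex_monomials n.+1 d)].

Lemma homog_monomialE d m : mdeg m = d ->
  mpoly_of_dhomog (insubd (0 : dhomog n.+1 K d) 'X_[m]) = 'X_[m].
Proof.
move=> dm; apply: (insubdK (0 : dhomog n.+1 K d)).
by rewrite -topredE /= dhomogX /= dm.
Qed.

Lemma homog_monomials_free d a : free (homog_monomials d a).
Proof.
set s := filter a (lex_monomials n.+1 d).
have us : uniq s by rewrite filter_uniq // lex_monomials_uniq.
apply/(@freeP _ _ _ (in_tuple (homog_monomials d a))) => k.
move/(congr1 (@mpoly_of_dhomog _ _ _)); rewrite raddf_sum /= => k0 i.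
have sz : size (homog_monomials d a) = size s by rewrite size_map.
have lti : (i < size s)%N by rewrite -sz.
have dnth (j : nat) : (j < size s)%N -> mdeg (nth 0%MM s j) = d.
  move=> lj; have := mem_nth 0%MM lj.
  by rewrite mem_filter mem_lex_monomials => /andP[_ /eqP].
have := congr1 (mcoeff (nth 0%MM s i)) k0; rewrite mcoeff0 => <-.
rewrite raddf_sum /= (bigD1 i) //= big1 ?addr0.
  by rewrite (nth_map 0%MM) // mcoeffZ homog_monomialE ?dnth // mcoeffX eqxx mulr1.
move=> j ne_ji; have ltj : (j < size s)%N by rewrite -sz.
rewrite (nth_map 0%MM) // mcoeffZ homog_monomialE ?dnth // mcoeffX nth_uniq //.
by rewrite (inj_eq val_inj) (negbTE ne_ji) mulr0.
Qed.

Lemma mem_span_homog_monomials d a (f : dhomog n.+1 K d) :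
  f \in <<homog_monomials d a>>%VS <-> {subset msupp f <= a}.
Proof.
split.
  move/(@coord_span _ _ _ (in_tuple (homog_monomials d a))) => ->; rewrite linear_sum /=.
  elim/big_ind: _ => [|g h IHg IHh m|i _ m].
  - by move=> m; rewrite msupp0.
  - by move/msuppD_le; rewrite mem_cat => /orP[/IHg|/IHh].
  have sz : size (homog_monomials d a) = size (filter a (lex_monomials n.+1 d)).
    by rewrite size_map.
  have lti : (i < size (filter a (lex_monomials n.+1 d)))%N by rewrite -sz.
  move/msuppZ_le; rewrite (nth_map 0%MM) //; have := mem_nth 0%MM lti.
  rewrite mem_filter mem_lex_monomials => /andP[am /eqP dm].
  by rewrite homog_monomialE // msuppX inE => /eqP ->.
move=> fa; have -> : f = \sum_(m <- msupp f) f@_m *: insubd (0 : dhomog n.+1 K d) 'X_[m].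
  apply: val_inj => /=; rewrite [LHS]mpolyE linear_sum big_seq [RHS]big_seq /=.
  apply: eq_bigr => m mf; rewrite homog_monomialE //.
  by have /dhomogP/(_ _ mf) := dhomog_is_dhomog f.
rewrite big_seq; apply: memv_suml => m mf; apply/memvZ/memv_span/map_f.
rewrite mem_filter mem_lex_monomials; apply/andP; split; first exact: fa.
by have /dhomogP/(_ _ mf) /eqP := dhomog_is_dhomog f.
Qed.

Lemma dim_homog_monomials d a :
  \dim <<homog_monomials d a>>%VS = count a (lex_monomials n.+1 d).
Proof.
by rewrite (eqP (homog_monomials_free d a)) size_map size_filter.
Qed.

Lemma dim_dhomog d : \dim {: dhomog n.+1 K d} = size (lex_monomials n.+1 d).
Proof.
have -> : fullv = <<homog_monomials d predT>>%VS.
  apply/vspaceP => f; rewrite memvf; apply/esym.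
  by apply/mem_span_homog_monomials.
by rewrite dim_homog_monomials count_predT.
Qed.

(** The degree [d] part of [I] is the span of its monomials, which are linearly independent, so its
    codimension is a count. *)
Lemma hilbert_polyP I p : monomial_ideal I ->
  hilbert_poly I p <->
  exists N, forall d, (N <= d)%N -> p.[d%:R] = (nonmembers I d)%:R.
Proof.
move=> mI; pose a m := asbool (I 'X_[m]).
have UP d : graded_part I <<homog_monomials d a>>%VS.
  move=> f; rewrite mem_span_homog_monomials (monomial_idealP f mI).
  by split=> h m /h /asboolP.
have codim d : (size (lex_monomials n.+1 d) - count a (lex_monomials n.+1 d))%N
    = nonmembers I d.
  by rewrite -(count_predC a) addKn.
split=> -[N NP]; exists N => d /NP.
  case=> U hU ->; have -> : U = <<homog_monomials d a>>%VS.
    by apply/vspaceP => f; apply/idP/idP => [/hU/UP|/UP/hU].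
  by rewrite dim_dhomog dim_homog_monomials codim.
move=> ->; exists <<homog_monomials d a>>%VS => //.
by rewrite dim_dhomog dim_homog_monomials codim.
Qed.

End HilbertFunction.

(** * Almost lexsegment ideals and lex expansions *)

Section LexOrder.
Variable n : nat.
Implicit Types m u v : 'X_{1..n}.

Lemma mnm_subK1 m i : (0 < m i)%N -> (m - U_(i) + U_(i))%MM = m.
Proof. by move=> mi; rewrite submK // lep1mP -lt0n. Qed.

Lemma mdeg_sub1 m i : (0 < m i)%N -> mdeg m = (mdeg (m - U_(i))).+1.
Proof. by move=> mi; rewrite -{1}(mnm_subK1 mi) mdegD mdeg1 addn1. Qed.

Lemma ltmc_exchange m (i j : 'I_n) : (0 < m j)%N -> (i < j)%N ->
  (m < (m - U_(j) + U_(i))%MM)%O.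
Proof.
move=> mj lt_ij; apply/ltmcP.
  by rewrite mdegD mdeg1 (mdeg_sub1 mj) addn1.
exists i => [k lt_ki|]; rewrite !(mnmDE, mnmBE, mnm1E).
  have /negbTE -> : j != k by apply: contraTneq lt_ki => <-; rewrite -leqNgt ltnW.
  have /negbTE -> : i != k by apply: contraTneq lt_ki => <-; rewrite ltnn.
  by rewrite subn0 addn0.
have /negbTE -> : j != i by apply: contraTneq lt_ij => ->; rewrite ltnn.
by rewrite eqxx; lia.
Qed.

Lemma lemc_U (i j : 'I_n) : (i <= j)%N -> (mnm1 j <= mnm1 i)%O.
Proof.
rewrite leq_eqVlt => /orP[/eqP/val_inj ->|lt_ij]; first exact: lexx.
have h : (0 < U_(j)%MM j)%N by rewrite mnm1E eqxx.
have := ltmc_exchange h lt_ij.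
have -> : (U_(j) - U_(j))%MM = 0%MM by apply/mnmP => k; rewrite mnmBE mnm0E subnn.
by rewrite add0m => /ltW.
Qed.

Lemma lepm_lt m m' : (m <= m')%MM -> m != m' -> exists i, (m i < m' i)%N.
Proof.
move=> /mnm_lepP le ne; apply: NNPP => h; case/eqP: ne; apply/mnmP => i.
apply/eqP; rewrite eqn_leq le leqNgt; apply/negP => lt; apply: h.
by exists i.
Qed.

Lemma lepm_sub1 m m' i : (m <= m')%MM -> (m i < m' i)%N -> (m <= m' - U_(i))%MM.
Proof.
move=> /mnm_lepP le lt; apply/mnm_lepP => k; rewrite mnmBE mnm1E.
by case: eqP => [<-|_]; rewrite ?subn0 //; lia.
Qed.

Lemma max_varP m : m != 0%MM ->
  exists2 i : 'I_n, (0 < m i)%N & forall k : 'I_n, (0 < m k)%N -> (k <= i)%N.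
Proof.
move=> m0; have [i mi] : exists i, (0 < m i)%N.
  have le0 : (0 <= m)%MM by apply/mnm_lepP => i; rewrite mnm0E.
  have ne0 : 0%MM != m by rewrite eq_sym.
  by have [i] := lepm_lt le0 ne0; rewrite mnm0E; exists i.
case: (@arg_maxnP _ i (fun k => (0 < m k)%N) (fun k => k : nat) mi) => k mk kP.
by exists k.
Qed.

(* Among the quotients of [m] by one of its variables, the one by the last
   variable is lexicographically largest. *)
Lemma lemc_div_last_var m u (i j : 'I_n) :
    mdeg m = (mdeg u).+1 -> (0 < m i)%N ->
    (forall k : 'I_n, (0 < m k)%N -> (k <= i)%N) ->
  ((u + U_(j))%MM <= m)%O -> (u <= (m - U_(i))%MM)%O.
Proof.
move=> dm mi imax le_um; rewrite leNgt; apply/negP => lt_vu.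
have dv : mdeg (m - U_(i)) = mdeg u by have := mdeg_sub1 mi; lia.
have [le_ji|lt_ij] := leqP j i.
  have : (m < (u + U_(j))%MM)%O.
    by rewrite -(mnm_subK1 mi); apply: ltmc_le_add => //; apply: lemc_U.
  by rewrite ltNge le_um.
case/(ltmcP dv): lt_vu => t eq_t lt_t.
(* If the first difference [t] is at or after [i], [m] has no variable beyond [t], so [m - U_(i)]
   divides [u] and the degrees make them equal. If [t < i < j], neither [U_(i)] nor [U_(j)] touches
   the comparison up to [t]. *)
have [le_it|lt_ti] := leqP i t.
  have eq_vu : (m - U_(i))%MM = u.
    apply: lepm_mdeg_eq => //; apply/mnm_lepP => k.
    case: (ltngtP k t) => [/eq_t -> //|lt_tk|/val_inj ->]; last exact: ltnW.
    rewrite mnmBE; case: (posnP (m k)) => [-> //|/imax].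
    by rewrite leqNgt (leq_ltn_trans le_it lt_tk).
  by rewrite eq_vu ltnn in lt_t.
have : (m < (u + U_(j))%MM)%O; last by rewrite ltNge le_um.
have nj (k : 'I_n) : (k < i)%N -> U_(j)%MM k = 0%N.
  by rewrite mnm1E => lt_ki; case: eqP => // jk; move: lt_ki lt_ij; rewrite jk; lia.
have ni (k : 'I_n) : (k < i)%N -> U_(i)%MM k = 0%N.
  by rewrite mnm1E => lt_ki; case: eqP => // ik; move: lt_ki; rewrite ik ltnn.
apply/ltmcP; first by rewrite mdegD mdeg1 addn1.
exists t => [k lt_kt|].
  have := eq_t _ lt_kt; rewrite mnmBE mnmDE nj ?ni ?subn0 ?addn0 //; lia.
by move: lt_t; rewrite mnmBE mnmDE nj ?ni ?subn0 ?addn0.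
Qed.

Lemma lex_min_exists (P : 'X_{1..n} -> Prop) m : P m ->
  exists2 u, P u & forall v, P v -> (u <= v)%O.
Proof.
elim/(@ltmwf n): m => m IH Pm.
case: (asboolP (exists2 y, (y < m)%O & P y)) => [[y lt Py]|h]; first exact: IH Py.
by exists m => // y Py; rewrite leNgt; apply/negP => lt; apply: h; exists y.
Qed.

End LexOrder.

(** * Monomials free of the last variable *)

Section LastVariable.
Variable n : nat.
Implicit Types m : 'X_{1..n.+1}.

Definition drop_last m : 'X_{1..n.+1} := (m - U_(ord_max) *+ m ord_max)%MM.

Lemma drop_last_ordmax m : drop_last m ord_max = 0%N.
Proof. by rewrite mnmBE mulmnE mnm1E eqxx mul1n subnn. Qed.

Lemma drop_lastE m (i : 'I_n.+1) : (i < n)%N -> drop_last m i = m i.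
Proof.
move=> lt_in; rewrite mnmBE mulmnE mnm1E.
have /negbTE -> : ord_max != i by apply: contraTneq lt_in => <-; rewrite /= ltnn.
by rewrite mul0n subn0.
Qed.

Lemma drop_lastK m : (drop_last m + U_(ord_max) *+ m ord_max)%MM = m.
Proof.
rewrite submK //; apply/mnm_lepP => i; rewrite mulmnE mnm1E.
by case: eqP => [->|]; rewrite ?mul1n ?mul0n.
Qed.

Lemma drop_last_le m : (drop_last m <= m)%MM.
Proof. exact: lem_subr. Qed.

Lemma drop_last_id m : m ord_max = 0%N -> drop_last m = m.
Proof. by move=> m0; rewrite /drop_last m0 mulm0n subm0. Qed.

Lemma drop_lastD m c : m ord_max = 0%N ->
  drop_last (m + U_(ord_max) *+ c)%MM = m.
Proof.
move=> m0; rewrite /drop_last mnmDE m0 mulmnE mnm1E eqxx mul1n add0n.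
exact: addmK.
Qed.

Lemma ordmaxP (i : 'I_n.+1) : (i < n)%N \/ i = ord_max.
Proof.
case: (ltnP i n) => [|le]; first by left.
by right; apply: val_inj => /=; have := ltn_ord i; lia.
Qed.

Lemma mnmwiden_surj m : m ord_max = 0%N -> exists u : 'X_{1..n}, m = mnmwiden u.
Proof.
move=> m0; exists [multinom m (widen_ord (leqnSn n) i) | i < n].
apply/mnmP => i; case: (ordmaxP i) => [lt_in|->]; last by rewrite mnmwiden_ordmax.
have -> : i = widen_ord (leqnSn n) (Ordinal lt_in) by exact: val_inj.
by rewrite mnmwiden_widen mnmE.
Qed.

Lemma mdeg_mnmwiden (u : 'X_{1..n}) : mdeg (mnmwiden u) = mdeg u.
Proof.
rewrite !mdegE big_ord_recr /= mnmwiden_ordmax addn0.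
by apply: eq_bigr => i _; rewrite mnmwiden_widen.
Qed.

Lemma mnmwiden_lem (u v : 'X_{1..n}) :
  (mnmwiden u <= mnmwiden v)%MM = (u <= v)%MM.
Proof.
apply/mnm_lepP/mnm_lepP => le i.
  by have := le (widen_ord (leqnSn n) i); rewrite !mnmwiden_widen.
case: (ordmaxP i) => [lt_in|->]; last by rewrite !mnmwiden_ordmax.
have -> : i = widen_ord (leqnSn n) (Ordinal lt_in) by exact: val_inj.
by rewrite !mnmwiden_widen.
Qed.

Lemma mnmwiden_ltmc (u v : 'X_{1..n}) : mdeg u = mdeg v ->
  (mnmwiden u < mnmwiden v)%O = (u < v)%O.
Proof.
move=> duv; apply/ltmcP/ltmcP => //; rewrite ?mdeg_mnmwiden // => -[i eqi lti].
  case: (ordmaxP i) => [lt_in|ei]; last by rewrite ei !mnmwiden_ordmax in lti.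
  have ei : i = widen_ord (leqnSn n) (Ordinal lt_in) by exact: val_inj.
  rewrite ei !mnmwiden_widen in lti; exists (Ordinal lt_in) => // k lt_k.
  by have := eqi (widen_ord (leqnSn n) k) lt_k; rewrite !mnmwiden_widen.
exists (widen_ord (leqnSn n) i); last by rewrite !mnmwiden_widen.
move=> k /= lt_ki; have lt_kn : (k < n)%N by apply: ltn_trans lt_ki _.
have -> : k = widen_ord (leqnSn n) (Ordinal lt_kn) by exact: val_inj.
by rewrite !mnmwiden_widen eqi.
Qed.

Lemma mnmwiden_lemc (u v : 'X_{1..n}) : mdeg u = mdeg v ->
  (mnmwiden u <= mnmwiden v)%O = (u <= v)%O.
Proof. by move=> duv; rewrite !leNgt mnmwiden_ltmc. Qed.

End LastVariable.

(** * Monomial criterion for almost lexsegment ideals and the effect of an expansion *)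

Section AlmostLex.
Variables (K : fieldType) (n : nat).
Implicit Types (I J L : {mpoly K[n.+1]} -> Prop) (m : 'X_{1..n.+1}).

(** For a strongly stable ideal this is equivalent to being saturated. *)
Definition cancels_last I :=
  forall m, I 'X_[m + U_(ord_max)] -> I 'X_[m].

(** For a monomial ideal satisfying [cancels_last], this is the lexsegment condition on [restr I],
    expressed in the larger ring. *)
Definition lex_closed_last0 I := forall m m',
  m ord_max = 0%N -> m' ord_max = 0%N -> mdeg m = mdeg m' -> (m <= m')%O ->
  I 'X_[m] -> I 'X_[m'].

(** Exchanging [x_n] for [x_i] in [m * x_n] puts every [m * x_i] into [I], and saturation then gives
    [m]. *)
Lemma strongly_stable_cancels_last I :
  strongly_stable I -> saturated I -> cancels_last I.
Proof.
move=> [mI ssI] satI m Im; apply: satI => i; rewrite -mpolyXD addmC.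
case: (ordmaxP i) => [lt_in|-> //].
have := ssI _ i ord_max Im; rewrite mnmDE mnm1E eqxx addn1 addmK.
by apply.
Qed.

Lemma cancels_last_saturated I :
  monomial_ideal I -> cancels_last I -> saturated I.
Proof.
move=> mI cI f fI; apply/(monomial_idealP f mI) => m mf; apply: cI.
have /(monomial_idealP _ mI) := fI ord_max; apply.
by rewrite mulrC (perm_mem (msuppMX _ _)) addmC; apply: map_f.
Qed.

Lemma lexsegment_strongly_stable I : lexsegment I -> strongly_stable I.
Proof.
case/lexsegmentP => mI lI; split=> // m i j Im mj lt_ij.
apply: lI Im; last by rewrite ltW // ltmc_exchange.
by rewrite mdegD mdeg1 addn1 -mdeg_sub1.
Qed.

Lemma cancels_lastMn I m c : cancels_last I ->
  I 'X_[m + U_(ord_max) *+ c] -> I 'X_[m].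
Proof.
move=> cI; elim: c => [|c IH]; first by rewrite mulm0n addm0.
by rewrite mulmSr addmA => /cI/IH.
Qed.

Lemma mem_drop_last I m : monomial_ideal I -> cancels_last I ->
  I 'X_[m] <-> I 'X_[drop_last m].
Proof.
move=> mI cI; split; first by rewrite -{1}(drop_lastK m) => /(cancels_lastMn cI).
by move=> Im; apply: monomial_ideal_upset Im (drop_last_le _).
Qed.

Lemma min_gen_last0 I m : cancels_last I -> min_gen I m -> m ord_max = 0%N.
Proof.
move=> cI [Im mmin]; apply/eqP; rewrite -leqn0 leqNgt; apply/negP => m0.
have Im' : I 'X_[m - U_(ord_max)] by apply: cI; rewrite mnm_subK1.
have := mdeg_sub1 m0; rewrite (mmin _ Im' (lem_subr _ _)); lia.
Qed.

Lemma restrX I u : monomial_ideal I -> cancels_last I ->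
  restr I 'X_[u] <-> I 'X_[mnmwiden u].
Proof.
move=> mI cI; rewrite /restr mono_idealX; split=> [[s [Is _]]|Iu].
  by rewrite -mnmwiden_lem; apply: monomial_ideal_upset.
have [g mg] := min_gen_below Iu; have [s eg] := mnmwiden_surj (min_gen_last0 cI mg).
by rewrite eg mnmwiden_lem in mg * => le; exists s.
Qed.

(** Strong stability is recovered from the right-hand side by first cancelling [x_n]: exchanging
    [x_j] for an earlier [x_i] then gives a lexicographically larger monomial of the same degree,
    and when [x_j] is [x_n] the exchanged monomial is a multiple of [drop_last m]. *)
Lemma almost_lexP I :
  almost_lex I <-> [/\ monomial_ideal I, cancels_last I & lex_closed_last0 I].
Proof.
split=> [[ssI satI /lexsegmentP[_ lI]]|[mI cI lI]].
  have mI := proj1 ssI; have cI := strongly_stable_cancels_last ssI satI.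
  split=> // m m' /mnmwiden_surj[u ->] /mnmwiden_surj[v ->].
  rewrite !mdeg_mnmwiden => duv; rewrite mnmwiden_lemc // => le.
  by move/(restrX u mI cI)/(lI _ _ duv le)/(restrX v mI cI).
split; last 2 first.
- exact: cancels_last_saturated.
- apply/lexsegmentP; split; first exact: mono_ideal_monomial.
  move=> u v duv le /(restrX u mI cI) Iu; apply/(restrX v mI cI).
  by apply: lI Iu; rewrite ?mnmwiden_ordmax ?mdeg_mnmwiden ?mnmwiden_lemc.
split=> // m i j Im mj lt_ij; move/(mem_drop_last m mI cI): Im => Im.
have lt_in : (i < n)%N by apply: leq_trans lt_ij _; rewrite -ltnS.
case: (ordmaxP j) => [lt_jn|ej]; last first.
  apply: monomial_ideal_upset Im _ => //; apply/mnm_lepP => k.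
  case: (ordmaxP k) => [lt_kn|->]; last by rewrite drop_last_ordmax.
  rewrite drop_lastE // mnmDE mnmBE ej mnm1E.
  have /negbTE -> : ord_max != k by apply: contraTneq lt_kn => <-; rewrite /= ltnn.
  by rewrite subn0 leq_addr.
have dj : (0 < drop_last m j)%N by rewrite drop_lastE.
have ne0 (k : 'I_n.+1) : (k < n)%N -> U_(k)%MM ord_max = 0%N.
  by rewrite mnm1E; case: eqP => // ->; rewrite /= ltnn.
have : I 'X_[drop_last m - U_(j) + U_(i)].
  apply: lI Im.
  - exact: drop_last_ordmax.
  - by rewrite mnmDE mnmBE drop_last_ordmax !ne0.
  - by rewrite mdegD mdeg1 addn1 -mdeg_sub1.
  - by rewrite ltW // ltmc_exchange.
move=> h; apply: monomial_ideal_upset h _ => //; apply/mnm_lepP => k.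
rewrite !mnmDE !mnmBE; have /mnm_lepP/(_ k) := drop_last_le m; rewrite mnmBE; lia.
Qed.

Lemma almost_lex_eq I J : eq_ideal I J -> almost_lex I -> almost_lex J.
Proof.
move=> IJ /almost_lexP[mI cI lI]; apply/almost_lexP; split.
- exact: monomial_ideal_eq mI.
- by move=> m /IJ/cI/IJ.
- by move=> m m' h1 h2 h3 h4 /IJ/(lI _ _ h1 h2 h3 h4)/IJ.
Qed.

Lemma saturated_lexsegment_cancels_last L :
  saturated L -> lexsegment L -> cancels_last L.
Proof. by move=> satL /lexsegment_strongly_stable/strongly_stable_cancels_last; apply. Qed.

Lemma saturated_lexsegment_almost_lex L :
  saturated L -> lexsegment L -> almost_lex L.
Proof.
move=> satL lL; apply/almost_lexP; split; first by case: lL.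
  exact: saturated_lexsegment_cancels_last.
by move=> m m' _ _; case/lexsegmentP: lL => _; apply.
Qed.

Lemma whole_ring_almost_lex : @almost_lex K n (@whole_ring K n).
Proof.
apply/almost_lexP; split=> //.
exists (fun=> True) => f; split=> // _; apply/mono_idealP => m _.
by exists m => //; apply: lepm_refl.
Qed.

(** If some [m1 / x_j] were in [I], then so would be [m] divided by its last variable, which is
    lexicographically at least [m1 / x_j]; this contradicts the minimality of [m]. *)
Lemma min_gen_lex_le I m m1 : almost_lex I ->
    min_gen I m -> (m1 <= m)%O -> mdeg m1 = mdeg m -> m1 ord_max = 0%N ->
  I 'X_[m1] -> min_gen I m1.
Proof.
move=> /almost_lexP[mI cI lI] mg le dm1 m10 Im1; split=> // u Iu le_u.
apply/eqP/contraT => ne; have [j lt_j] := lepm_lt le_u ne.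
have m1j : (0 < m1 j)%N by lia.
have d1 := mdeg_sub1 m1j.
have Iv : I 'X_[m1 - U_(j)] := monomial_ideal_upset mI Iu (lepm_sub1 le_u lt_j).
have m0 := min_gen_last0 cI mg.
have [|i mi imax] := @max_varP _ m.
  by rewrite -mdeg_eq0; lia.
have d := mdeg_sub1 mi.
have Iw : I 'X_[m - U_(i)].
  apply: lI Iv; rewrite ?mnmBE ?m0 ?m10 //; first by lia.
  apply: (lemc_div_last_var (j := j)) => //; first by lia.
  by rewrite mnm_subK1.
by have := mg.2 _ Iw (lem_subr _ _); move=> e; rewrite e in d; lia.
Qed.

(** A multiple of [m] not of the form [m * x_n ^ c] is divisible by some [m * x_k] with [k < n]. For
    [k >= max_var m] this is a new generator; for smaller [k] strong stability supplies another old
    one. The expansion of 1 obeys the same description. *)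
Lemma expansionP I m J : almost_lex I -> min_gen I m -> expansion I m J ->
  monomial_ideal J /\
  forall m', J 'X_[m'] <->
    I 'X_[m'] /\ forall c, m' <> (m + U_(ord_max) *+ c)%MM.
Proof.
move=> alI mg; have /almost_lexP[mI cI _] := alI; have [ssI _ _] := alI.
have m0 := min_gen_last0 cI mg.
have last_part m' : (forall c, m' <> m + U_(ord_max) *+ c)%MM -> (m <= m')%MM ->
    exists2 k : 'I_n.+1, (k < n)%N & (m + U_(k) <= m')%MM.
  move=> ne le; have [le_d|] := boolP (drop_last m' <= m)%MM.
    case: (ne (m' ord_max)); rewrite -{1}(drop_lastK m'); congr (_ + _)%MM.
    apply/mnmP => k; apply/eqP; rewrite eqn_leq (mnm_lepP le_d) /=.
    case: (ordmaxP k) => [lt_kn|->]; last by rewrite m0.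
    by rewrite drop_lastE // (mnm_lepP le).
  rewrite negb_forall => /existsP[k]; rewrite -ltnNge => lt_k.
  have lt_kn : (k < n)%N.
    by case: (ordmaxP k) => // ek; rewrite ek drop_last_ordmax in lt_k.
  exists k => //; rewrite drop_lastE // in lt_k.
  apply/mnm_lepP => i; rewrite mnmDE mnm1E; have := mnm_lepP le i.
  by case: eqP => [<-|_]; lia.
have not_le (k : 'I_n.+1) c : (k < n)%N -> ~ (m + U_(k) <= m + U_(ord_max) *+ c)%MM.
  move=> lt_kn /mnm_lepP/(_ k); rewrite !mnmDE mulmnE !mnm1E eqxx.
  have /negbTE -> : ord_max != k by apply: contraTneq lt_kn => <-; rewrite /= ltnn.
  by lia.
case=> [[_ JE]|[IE em JE]]; split; first by eexists; exact: JE.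
- move=> m'; rewrite (JE 'X_[m']) mono_idealX; split.
    case=> s [[[Is smin] ne_sm]|[k [lek lt_kn ->]]] le_s; split.
    + exact: monomial_ideal_upset Is le_s.
    + move=> c em'; apply/ne_sm/(mg.2 _ Is); apply/mnm_lepP => i.
      have := mnm_lepP le_s i; rewrite em' mnmDE mulmnE mnm1E.
      have s0 : s ord_max = 0%N by apply: min_gen_last0 cI _; split.
      case: (ordmaxP i) => [lt_in|->]; last by rewrite s0.
      have /negbTE -> : ord_max != i by apply: contraTneq lt_in => <-; rewrite /= ltnn.
      by rewrite mul0n addn0.
    + apply: monomial_ideal_upset mg.1 _ => //.
      by apply: lepm_trans le_s; apply: lem_addr.
    + by move=> c em'; rewrite em' in le_s; apply: not_le le_s.
  case=> Im' ne; have [s ms le_s] := min_gen_below Im'.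
  have [es|/eqP ne_s] := eqVneq s m; last by exists s => //; left.
  rewrite es in le_s; have [k lt_kn le_k] := last_part _ ne le_s.
  have [le_mk|lt_km] := leqP (max_var m) k.
    by exists (m + U_(k))%MM => //; right; exists k.
  have mn0 : m != 0%MM.
    apply: contraTneq lt_km => ->; rewrite /max_var big_pred0 // => i.
    by rewrite mnm0E.
  have [r mr rmax] := max_varP mn0.
  have lt_kr : (k < r)%N.
    by apply: leq_trans lt_km _; apply/bigmax_leqP => i; apply: rmax.
  (* The monomial [m * x_k / x_r] lies in [I], and a minimal generator dividing it has a smaller
     exponent of [x_r] than [m], so it survives. *)
  have Iu := ssI.2 _ _ _ mg.1 mr lt_kr.
  have [s' ms' le_s'] := min_gen_below Iu; exists s'.
    left; split=> // es'; have := mnm_lepP le_s' r; rewrite es' mnmDE mnmBE !mnm1E eqxx.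
    have /negbTE -> : k != r by apply: contraTneq lt_kr => ->; rewrite ltnn.
    by lia.
  apply: lepm_trans le_s' _; apply: lepm_trans le_k; apply/mnm_lepP => i.
  by rewrite !mnmDE mnmBE leq_add2r leq_subr.
- by eexists; exact: JE.
move=> m'; rewrite (JE 'X_[m']) mono_idealX; split.
  case=> s [k lt_kn ->] le_s; split; first exact/IE.
  move=> c em'; rewrite em' em in le_s; apply: (not_le k c lt_kn).
  by rewrite em !add0m in le_s *.
case=> _ ne; have [|k lt_kn le_k] := last_part _ ne.
  by rewrite em; apply/mnm_lepP => i; rewrite mnm0E.
by exists U_(k)%MM; [exists k | rewrite em add0m in le_k].
Qed.

(** Lexicographic closure could only fail at the removed [m]. But a monomial [m1 <= m] of [I] of the
    same degree and free of [x_n] is a minimal generator, so [m1 = m] by the choice of [m], and [m1]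
    is removed too. *)
Lemma lex_expansion_almost_lex I J : lex_expansion I J -> almost_lex J.
Proof.
move=> [alI [m [mg mmin ex]]]; have [mJ JE] := expansionP alI mg ex.
have /almost_lexP[mI cI lI] := alI; have m0 := min_gen_last0 cI mg.
apply/almost_lexP; split=> //.
  move=> m' /JE[Im' ne]; apply/JE; split; first exact: cI.
  by move=> c em; apply: (ne c.+1); rewrite em mulmSr addmA.
move=> m1 m2 m10 m20 d12 le12 /JE[Im1 ne1]; apply/JE; split; first exact: lI Im1.
move=> c em2; have em : m2 = m.
  by rewrite -(drop_last_id m20) em2 drop_lastD.
rewrite em in d12 le12; have mg1 := min_gen_lex_le alI mg le12 d12 m10 Im1.
case: (ne1 0%N); rewrite mulm0n addm0; apply: le_anti.
by rewrite le12 mmin.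
Qed.

(** From degree [mdeg m] on, exactly one monomial is lost in each degree, namely [m] times a power
    of [x_n]. *)
Lemma nonmembers_expansion I m J d : monomial_ideal I -> I 'X_[m] ->
    (forall m', J 'X_[m'] <->
      I 'X_[m'] /\ forall c, m' <> (m + U_(ord_max) *+ c)%MM) ->
  (mdeg m <= d)%N -> nonmembers J d = (nonmembers I d).+1.
Proof.
move=> mI Im JE le_d; set w := (m + U_(ord_max) *+ (d - mdeg m))%MM.
have dw : mdeg w = d by rewrite mdegD mdegMn mdeg1 mul1n subnKC.
have Iw : I 'X_[w] by apply: monomial_idealDr.
set s := lex_monomials n.+1 d; set a := fun u => ~~ asbool (I 'X_[u]).
have -> : nonmembers J d = count (predU (pred1 w) a) s.
  apply: eq_in_count => u; rewrite mem_lex_monomials /a => /eqP du /=.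
  apply/idP/idP => [/asboolP nJ|/orP[/eqP -> |/asboolP nI]]; last 2 first.
  - by apply/asboolP => /JE[_ /(_ (d - mdeg m)%N)].
  - by apply/asboolP => /JE[].
  case: (asboolP (I 'X_[u])) => Iu; last by rewrite orbT.
  rewrite orbF; apply/eqP; apply: NNPP => ne; apply: nJ; apply/JE; split=> // c eu.
  apply: ne; rewrite eu /w; congr (_ + _ *+ _)%MM.
  by move: du; rewrite eu mdegD mdegMn mdeg1 mul1n => <-; rewrite addKn.
have := count_predUI (pred1 w) a s; have -> : count (predI (pred1 w) a) s = 0%N.
  rewrite -(count_pred0 s); apply: eq_count => u /=.
  by case: eqP => //= ->; rewrite /a (introT (asboolP _) Iw).
rewrite addn0 => ->; rewrite count_uniq_mem ?lex_monomials_uniq //.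
by rewrite mem_lex_monomials dw eqxx.
Qed.

Lemma hilbert_poly_lex_expansion I J p :
  lex_expansion I J -> hilbert_poly I p -> hilbert_poly J (p + 1).
Proof.
move=> [alI [m [mg mmin ex]]]; have [mJ JE] := expansionP alI mg ex.
have /almost_lexP[mI cI lI] := alI; have m0 := min_gen_last0 cI mg.
case/(hilbert_polyP p mI) => N NP; apply/hilbert_polyP => //.
exists (maxn N (mdeg m)) => d; rewrite geq_max => /andP[leN le_d].
by rewrite hornerD hornerC NP // (nonmembers_expansion mI mg.1 JE le_d) natr1.
Qed.

Lemma hilbert_poly_eq I J p : eq_ideal I J -> hilbert_poly I p -> hilbert_poly J p.
Proof.
move=> IJ [N NP]; exists N => d /NP[U UI pU]; exists U => // f.
by rewrite UI; apply: IJ.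
Qed.

Lemma lex_expansionsP c I J p : lex_expansions c I J ->
  almost_lex I -> hilbert_poly I p -> almost_lex J /\ hilbert_poly J (p + c%:R).
Proof.
move=> ex; elim: ex p => {c I J} [I J IJ|c I J M ex _ IH] p alI hI.
  by rewrite addr0; split; [apply: almost_lex_eq alI | apply: hilbert_poly_eq hI].
rewrite -natr1 [c%:R + 1]addrC addrA; apply: IH.
  exact: lex_expansion_almost_lex ex.
exact: hilbert_poly_lex_expansion ex hI.
Qed.

End AlmostLex.

(** * Chains of lex expansions *)

Section Chains.
Variables (K : fieldType) (n : nat).
Implicit Types (I J L : {mpoly K[n.+1]} -> Prop) (m : 'X_{1..n.+1}).

Lemma eq_whole_ring I : monomial_ideal I -> I 'X_[0%MM] -> eq_ideal I (@whole_ring K n).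
Proof.
move=> mI I0 f; split=> // _; apply/(monomial_idealP f mI) => m _.
by rewrite -[m]add0m; apply: monomial_idealDr.
Qed.

(* A smallest monomial without [x_n] of least degree in [L] but not in [I] is a
   minimal generator of [L]: its proper divisors in [L] lie in [I]. *)
Lemma lex_expansion_exists L I : almost_lex L -> almost_lex I ->
    (forall m, I 'X_[m] -> L 'X_[m]) ->
    (exists2 m : 'X_{1..n.+1}, m ord_max = 0%N & L 'X_[m] /\ ~ I 'X_[m]) ->
  exists J (m : 'X_{1..n.+1}), [/\ lex_expansion L J, m ord_max = 0%N,
    L 'X_[m] /\ ~ J 'X_[m],
    forall m', J 'X_[m'] -> L 'X_[m'] & forall m', I 'X_[m'] -> J 'X_[m']].
Proof.
move=> alL alI IL [x0 x00 [Lx0 nIx0]].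
have /almost_lexP[mL cL lL] := alL; have /almost_lexP[mI cI lI] := alI.
pose P d := exists2 x : 'X_{1..n.+1}, x ord_max = 0%N &
  [/\ mdeg x = d, L 'X_[x] & ~ I 'X_[x] ].
have exd : exists d, asbool (P d).
  by exists (mdeg x0); apply/asboolP; exists x0.
case: (ex_minnP exd) => d /asboolP[x xn [dx Lx nIx]] dmin.
have [//|m [mn dm Lm] mmin] := @lex_min_exists _
  (fun m : 'X_{1..n.+1} => [/\ m ord_max = 0%N, mdeg m = d & L 'X_[m] ]) x.
(* [m] is least among all monomials of [L] of degree [d] free of [x_n], missing or not; if it lay in
   [I], lexicographic closure of [I] would give [x]. *)
have nIm : ~ I 'X_[m].
  by move=> Im; apply/nIx/(lI m) => //; [rewrite dm | apply: mmin].
have mg : min_gen L m.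
  split=> // m' Lm' le; apply: lepm_mdeg_eq => //.
  apply/eqP; rewrite eqn_leq lepm_mdeg //= dm; apply: dmin; apply/asboolP.
  exists m'; first by have := mnm_lepP le ord_max; rewrite mn leqn0 => /eqP.
  by split=> // Im'; apply: nIm; apply: monomial_ideal_upset le.
have gmin m' : min_gen L m' -> mdeg m' = mdeg m -> (m <= m')%O.
  move=> mg'; rewrite dm => dm'; apply: mmin; split=> //.
    exact: min_gen_last0 mg'.
  exact: mg'.1.
have [J ex] : exists J, expansion L m J.
  have [em|m0] := eqVneq m 0%MM.
    eexists; right; split; first by apply: eq_whole_ring; rewrite // -em.
      exact: em.
    by move=> f; exact: iff_refl.
  eexists; left; split; last by move=> f; exact: iff_refl.
  have [ssL satL _] := alL; split=> //.
  - move=> LE; case/eqP: m0; apply/esym/mg.2; first exact/LE.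
    by apply/mnm_lepP => i; rewrite mnm0E.
  - exact/eqP.
  (* A member of [Right m] has the degree of [m] and is lexicographically smaller, so the choice of
     [m] excludes it from the generators. *)
  - move=> m' [i [j [lt_i ej mi em']]] mg'.
    have dm' : mdeg m' = mdeg m by rewrite em' mdegD mdeg1 addn1 -mdeg_sub1.
    have := gmin _ mg' dm'; rewrite leNgt; case/negP.
    have mj : (0 < m' j)%N by rewrite em' mnmDE mnm1E eqxx addn1.
    have lt_ij : (i < j)%N by rewrite ej.
    have := ltmc_exchange mj lt_ij; congr (_ < _)%O.
    by rewrite em' addmK mnm_subK1.
have [mJ JE] := expansionP alL mg ex.
exists J, m; split=> //.
- by split=> //; exists m.
- by split=> // /JE[_ /(_ 0%N)]; rewrite mulm0n addm0.
- by move=> m' /JE[].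
- move=> m' Im'; apply/JE; split; first exact: IL.
  by move=> c em'; rewrite em' in Im'; apply/nIm/(cancels_lastMn cI Im').
Qed.

(** Induction on the number of monomials free of [x_n] in [L] but not in [I]. The bound [D] makes
    this set finite, and a suitable expansion shrinks it while staying above [I]. *)
Lemma lex_expansions_exist L I : almost_lex L -> almost_lex I ->
    (forall m, I 'X_[m] -> L 'X_[m]) ->
    (exists D, forall m, m ord_max = 0%N -> (D <= mdeg m)%N ->
      L 'X_[m] -> I 'X_[m]) ->
  exists c, lex_expansions c L I.
Proof.
move=> alL alI IL [D LD].
pose gap J := [pred m : 'X_{1..n.+1 < D} |
  [&& m ord_max == 0%N, asbool (J 'X_[m]) & ~~ asbool (I 'X_[m])]].
have [k] := ubnP #|gap L|; elim: k L alL IL LD => // k IH L alL IL LD lt_k.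
have /almost_lexP[mL cL _] := alL; have /almost_lexP[mI cI _] := alI.
case: (asboolP (exists2 m : 'X_{1..n.+1}, m ord_max = 0%N & L 'X_[m] /\ ~ I 'X_[m])) => [h|nh].
  have [J [m [ex m0 [Lm nJm] JL IJ]]] := lex_expansion_exists alL alI IL h.
  have [|||c cP] := IH J _ IJ.
  - exact: lex_expansion_almost_lex ex.
  - by move=> u u0 /(LD u u0) LI /JL/LI.
  - rewrite ltnS in lt_k; apply: leq_trans lt_k; apply: proper_card; apply/properP; split.
      apply/subsetP => u; rewrite !inE => /and3P[-> /asboolP/JL Lu ->].
      by rewrite (introT (asboolP _) Lu).
    have nIm : ~ I 'X_[m] by move/IJ.
    have lt_m : (mdeg m < D)%N.
      by rewrite ltnNge; apply/negP => le; apply/nIm/LD.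
    exists (BMultinom lt_m); rewrite !inE /= m0 eqxx /=.
      by apply/andP; split; [apply/asboolP | apply/negP => /asboolP].
    by apply/negP => /andP[/asboolP].
  by exists c.+1; apply: lex_expansionsS ex cP.
exists 0%N; apply: lex_expansions0; apply: eq_monomial_ideal => // m; split; last exact: IL.
move/(mem_drop_last m mL cL) => Lm; apply/(mem_drop_last m mI cI); apply: NNPP => nI.
by apply: nh; exists (drop_last m); first exact: drop_last_ordmax.
Qed.

End Chains.

(** * Saturated lexsegment ideals *)

Section LexPrefix.
Implicit Types s e : seq nat.

Lemma take_lexi k s s' : (s <= s')%O -> (take k s <= take k s')%O.
Proof.
elim: s s' k => [|x s IH] [|y s'] [|k] //=.
rewrite !lexi_cons => /andP[-> /implyP h]; apply/implyP => /h; exact: IH.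
Qed.

Lemma lexi_nth s s' : (size s <= size s')%N ->
  (forall i, (nth 0%N s i <= nth 0%N s' i)%N) -> (s <= s')%O.
Proof.
elim: s s' => [|x s IH] [|y s'] //= le h; rewrite lexi_cons.
rewrite leEnat (h 0%N) /=; apply/implyP => _; apply: IH => // i.
exact: (h i.+1).
Qed.

(** The fixed length makes a least element exist: minimise the head, then the tail under that
    head. *)
Lemma lexi_min_exists k (P : seq nat -> Prop) :
    (exists2 s, size s = k & P s) ->
  exists e, [/\ size e = k, P e & forall s, size s = k -> P s -> (e <= s)%O].
Proof.
elim: k P => [|k IH] P.
  by case=> s /size0nil -> P0; exists [::]; split=> // s /size0nil ->.
case=> [[|x s]] //= [ss] Ps.
pose Q a := exists2 s, size s = k & P (a :: s).
have exQ : exists a, asbool (Q a) by exists x; apply/asboolP; exists s.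
case: (ex_minnP exQ) => a /asboolP Qa amin.
have [e [se Pe emin]] := IH _ Qa; exists (a :: e); split=> //=; first by rewrite se.
move=> [|b t] //= [st] Pt; rewrite lexi_cons.
have le_ab : (a <= b)%N by apply: amin; apply/asboolP; exists t.
rewrite leEnat le_ab /=; apply/implyP => le_ba; apply: emin => //.
by have -> : a = b by apply/eqP; rewrite eqn_leq le_ab.
Qed.

End LexPrefix.

Section Saturation.
Variables (K : fieldType) (n : nat).
Implicit Types (I J L : {mpoly K[n.+1]} -> Prop) (m : 'X_{1..n.+1}).

(* The nonzero saturated lexsegment ideals are those spanned by the monomials
   whose first exponents are lexicographically at least a given vector [e]. *)
Definition lex_prefix_ideal (e : seq nat) : {mpoly K[n.+1]} -> Prop :=
  supp_ideal (fun m => (e <= take (size e) m)%O).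

Lemma lex_prefix_idealX e m :
  lex_prefix_ideal e 'X_[m] <-> (e <= take (size e) m)%O.
Proof. exact: supp_idealX. Qed.

Lemma lex_prefix_ideal_monomial e : monomial_ideal (lex_prefix_ideal e).
Proof.
apply: supp_ideal_monomial => m m' le lem; apply: le_trans le _.
apply/take_lexi/lexi_nth => [|i]; first by rewrite !size_tuple.
case: (ltnP i n.+1) => [lt|ge]; last by rewrite !nth_default ?size_tuple.
by have := mnm_lepP lem (Ordinal lt); rewrite !(mnm_nth 0%N).
Qed.

Lemma lex_prefix_ideal_lexsegment e : lexsegment (lex_prefix_ideal e).
Proof.
apply/lexsegmentP; split; first exact: lex_prefix_ideal_monomial.
move=> m m' dm le /lex_prefix_idealX h; apply/lex_prefix_idealX.
apply: le_trans h _; apply: take_lexi.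
by move: le; rewrite leEmnm dm eqhead_lexiE.
Qed.

(** The comparison reads only the first [size e <= n] exponents, hence not that of [x_n]. *)
Lemma lex_prefix_ideal_saturated e : (size e <= n)%N -> saturated (lex_prefix_ideal e).
Proof.
move=> se; apply: cancels_last_saturated; first exact: lex_prefix_ideal_monomial.
move=> m /lex_prefix_idealX h; apply/lex_prefix_idealX; apply: le_trans h _.
apply: lexi_nth => [|i]; first by rewrite !size_take !size_tuple.
case: (ltnP i (size e)) => [lt|ge]; last first.
  by rewrite !nth_default ?size_take ?size_tuple //; case: ifP; lia.
rewrite !nth_take //; have lti : (i < n.+1)%N by lia.
have := mnmDE (Ordinal lti) m U_(ord_max); rewrite !(mnm_nth 0%N) /= => ->.
rewrite -(mnm_nth 0%N U_(ord_max) (Ordinal lti)) mnm1E.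
by rewrite -(inj_eq val_inj) /=; case: eqP => //; lia.
Qed.

(** The zero ideal contains no monomial, so it has no least exponent vector and is handled apart
    from the ideals [lex_prefix_ideal e]. *)
Lemma zero_ideal_lexsegment : lexsegment (supp_ideal (K := K) (n := n.+1) (fun=> False)).
Proof.
apply/lexsegmentP; split; first exact: supp_ideal_monomial.
by move=> m m' _ _ /supp_idealX.
Qed.

Lemma zero_ideal_saturated : saturated (supp_ideal (K := K) (n := n.+1) (fun=> False)).
Proof.
apply: cancels_last_saturated; first exact: supp_ideal_monomial.
by move=> m /supp_idealX.
Qed.

(** Let [e] be the least vector of first [n - 1] exponents in [I], attained by [w] free of [x_n]. In
    each degree from [mdeg w] on, [w] times a power of [x_(n-1)] is a monomial [v] of [I],
    lexicographically least among those free of [x_n] with prefix at least [e]. *)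
Lemma almost_lex_prefix I : (0 < n)%N -> almost_lex I -> (exists m, I 'X_[m]) ->
  exists e, [/\ size e = n.-1,
    forall m, I 'X_[m] -> lex_prefix_ideal e 'X_[m] &
    exists D, forall m, m ord_max = 0%N -> (D <= mdeg m)%N ->
      lex_prefix_ideal e 'X_[m] -> I 'X_[m]].
Proof.
move=> n0 /almost_lexP[mI cI lI] [x Ix].
pose Q s := exists2 m : 'X_{1..n.+1}, I 'X_[m] & take n.-1 m = s.
have sz m : size (take n.-1 m) = n.-1 by rewrite size_takel // size_tuple; lia.
have [|e [se [m0 Im0 em0] emin]] := @lexi_min_exists n.-1 Q.
  by exists (take n.-1 x) => //; exists x.
exists e; split=> //.
  by move=> m Im; apply/lex_prefix_idealX; rewrite se; apply: emin => //; exists m.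
pose w := drop_last m0.
have Iw : I 'X_[w] by apply/(mem_drop_last m0 mI cI).
have ltp : (n.-1 < n.+1)%N by lia.
pose pn : 'I_n.+1 := Ordinal ltp.
exists (mdeg w) => m mn le_d /lex_prefix_idealX; rewrite se => le_e.
pose v := (w + U_(pn) *+ (mdeg m - mdeg w))%MM.
have vi (i : 'I_n.+1) : (i < n.-1)%N -> v i = m0 i.
  move=> lt; rewrite mnmDE mulmnE mnm1E /w drop_lastE; last by lia.
  have /negbTE -> : pn != i by apply: contraTneq lt => <-; rewrite /= ltnn.
  by rewrite mul0n addn0.
have vn : v ord_max = 0%N.
  rewrite mnmDE mulmnE mnm1E drop_last_ordmax.
  by rewrite -(inj_eq val_inj) /=; case: eqP => //; lia.
have dv : mdeg v = mdeg m by rewrite mdegD mdegMn mdeg1 mul1n subnKC.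
have tv : take n.-1 v = e.
  rewrite -em0; apply: (@eq_from_nth _ 0%N); rewrite !sz // => i lt.
  rewrite !nth_take //; have lti : (i < n.+1)%N by lia.
  by have := vi (Ordinal lti) lt; rewrite !(mnm_nth 0%N).
apply: (lI v) => //; last by apply: monomial_idealDr.
rewrite leNgt; apply/negP => lt_mv.
(* If [m < v], both have prefix [e]; as both are free of [x_n] and of the same degree, the exponents
   of [x_(n-1)] agree too, so [m = v]. *)
have tm : take n.-1 m = take n.-1 v.
  apply: le_anti; rewrite tv le_e andbT -tv; apply: take_lexi.
  by have := ltW lt_mv; rewrite leEmnm dv eqhead_lexiE.
have eqi (i : 'I_n.+1) : (i < n.-1)%N -> m i = v i.
  move=> lt; have := congr1 (fun s => nth 0%N s i) tm.
  by rewrite /= !nth_take // !(mnm_nth 0%N).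
have mv i : i != pn -> m i = v i.
  move=> ne; case: (ordmaxP i) => [lt_in|->]; last by rewrite mn vn.
  apply: eqi; have : i != pn :> nat by rewrite (inj_eq val_inj).
  by rewrite /=; lia.
have dE (u : 'X_{1..n.+1}) : mdeg u = (u pn + \sum_(i | i != pn) u i)%N.
  by rewrite mdegE (bigD1 pn).
have mvp : m pn = v pn.
  have := dv; rewrite !dE; have -> : (\sum_(i | i != pn) v i = \sum_(i | i != pn) m i)%N.
    by apply: eq_bigr => i /mv.
  by lia.
have mvE : m = v by apply/mnmP => i; have [->|/mv] := eqVneq i pn.
by rewrite mvE ltxx in lt_mv.
Qed.

End Saturation.

(** * Hilbert polynomials of saturated lexsegment ideals *)

Section MonomialCount.

Definition incr_head (s : seq nat) := if s is a :: s' then a.+1 :: s' else [::].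

(** Splitting by head zero or positive yields Pascal's rule for the lengths and the recursion of
    [lex_cocount] in the head of [e]. *)
Fixpoint exponents (k d : nat) : seq (seq nat) :=
  if k is k'.+1 then
    (fix aux d := map (cons 0%N) (exponents k' d) ++
      (if d is d'.+1 then map incr_head (aux d') else [::])) d
  else if d is 0%N then [:: [::]] else [::].

Lemma exponentsS0 k : exponents k.+1 0 = map (cons 0%N) (exponents k 0).
Proof. by rewrite /= cats0. Qed.

Lemma exponentsSS k d : exponents k.+1 d.+1 =
  map (cons 0%N) (exponents k d.+1) ++ map incr_head (exponents k.+1 d).
Proof. by []. Qed.

Lemma mem_exponents k d s :
  (s \in exponents k d) = (size s == k) && (sumn s == d).
Proof.
elim: k d s => [|k IHk] d s; first by case: d s => [|d] [|a s].
elim: d s => [|d IHd] s.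
  rewrite exponentsS0; apply/mapP/andP => [[t]|[]].
    by rewrite IHk => /andP[/eqP <- st ->] /=; rewrite eqxx.
  case: s => // a s /=; rewrite eqSS addn_eq0 => ss /andP[/eqP -> s0].
  by exists s => //; rewrite IHk ss s0.
rewrite exponentsSS mem_cat; apply/orP/andP => [[/mapP[t]|/mapP[t]]|[]].
- by rewrite IHk => /andP[/eqP <- st ->] /=; rewrite eqxx.
- by rewrite IHd; case: t => // a t /= /andP[st sd] -> /=; rewrite addSn eqSS.
case: s => [|[|a] s] //=; rewrite eqSS => ss sd; [left|right]; apply/mapP.
  by exists s => //; rewrite IHk ss sd.
by exists (a :: s) => //; rewrite IHd /= eqSS ss.
Qed.

Lemma exponents_uniq k d : uniq (exponents k d).
Proof.
elim: k d => [|k IHk] d; first by case: d.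
elim: d => [|d IHd]; first by rewrite exponentsS0 map_inj_uniq // => s t [].
rewrite exponentsSS cat_uniq map_inj_uniq ?IHk //=; last by move=> s t [].
rewrite map_inj_in_uniq ?IHd ?andbT.
  by apply/hasPn => s /mapP[[|a t] _ ->] /=; apply/mapP => -[].
move=> s t; rewrite -/(exponents k.+1 d) !mem_exponents => /andP[/eqP ss _] /andP[/eqP st _].
by case: s ss => // a s _; case: t st => // b t _ [-> ->].
Qed.

Lemma count_lex_monomials k d (P : pred (seq nat)) :
  count (fun m : 'X_{1..k} => P m) (lex_monomials k d) = count P (exponents k d).
Proof.
rewrite -(count_map (fun m : 'X_{1..k} => m : seq nat)); apply/permP/uniq_perm.
- rewrite map_inj_uniq ?lex_monomials_uniq // => m m' /val_inj; exact: val_inj.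
- exact: exponents_uniq.
move=> s; rewrite mem_exponents; apply/mapP/andP => [[m]|[ss sd]].
  rewrite mem_lex_monomials => /eqP <- ->; split; first by rewrite size_tuple.
  by rewrite sumnE.
exists [multinom Tuple ss] => //; rewrite mem_lex_monomials -(eqP sd).
by rewrite sumnE.
Qed.

Lemma size_exponentsS k d : size (exponents k.+1 d.+1) =
  (size (exponents k d.+1) + size (exponents k.+1 d))%N.
Proof. by rewrite exponentsSS size_cat !size_map. Qed.

Lemma size_exponents k d : size (exponents k.+1 d) = 'C(d + k, k).
Proof.
elim: k d => [|k IHk]; elim=> [|d IHd].
- by [].
- by rewrite size_exponentsS IHd !bin0.
- by rewrite exponentsS0 size_map IHk !add0n !binn.
- by rewrite size_exponentsS IHk IHd !(addSn, addnS) [in RHS]binS addnC.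
Qed.

Lemma size_exponents_sum k d :
  size (exponents k d.+1) = (\sum_(i < k) 'C(d + i, i))%N.
Proof.
elim: k => [|k IHk]; first by rewrite big_ord0.
by rewrite size_exponentsS IHk big_ord_recr /= size_exponents.
Qed.

End MonomialCount.

(** * Binomial polynomials and uniqueness of the b-sequence *)

Section BinomialPolynomials.
Implicit Types x y : rat.

Definition binr (k : nat) x : rat := (k`!%:R)^-1 * \prod_(j < k) (x - j%:R).

Lemma horner_binp q k x : (binp q k).[x] = binr k q.[x].
Proof.
rewrite hornerZ horner_prod; congr (_ * _); apply: eq_bigr => j _.
by rewrite hornerD hornerN -polyC_natr hornerC.
Qed.

Lemma binr0 x : binr 0 x = 1.
Proof. by rewrite /binr big_ord0 mulr1 fact0 invr1. Qed.

Lemma binr1 x : binr 1 x = x.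
Proof. by rewrite /binr big_ord_recl big_ord0 invr1 mul1r mulr1 subr0. Qed.

Lemma binr_pascal k x : binr k.+1 (x + 1) = binr k.+1 x + binr k x.
Proof.
rewrite /binr big_ord_recl big_ord_recr /=.
have -> : \prod_(i < k) (x + 1 - (bump 0 i)%:R) = \prod_(i < k) (x - i%:R).
  by apply: eq_bigr => i _; rewrite /bump /= add1n -natr1; ring.
have k0 : k.+1%:R != 0 :> rat by rewrite pnatr_eq0.
have f0 : k`!%:R != 0 :> rat by rewrite pnatr_eq0 -lt0n fact_gt0.
rewrite factS natrM -natr1 in k0 *; field.
by rewrite k0 f0.
Qed.

Lemma binr_nat k d : binr k d%:R = 'C(d, k)%:R.
Proof.
elim: d k => [|d IH] [|k]; rewrite ?binr0 ?bin0 //.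
  by rewrite /binr big_ord_recl subr0 !mul0r mulr0 bin0n.
by rewrite -natr1 binr_pascal !IH binS natrD.
Qed.

(** The summand that [b_i = b] contributes when a Hilbert polynomial is written by its
    b-sequence. *)
Definition bterm (i b : nat) : {poly rat} :=
  binp ('X + i%:R) i.+1 - binp ('X + i%:R - b%:R) i.+1.

Lemma horner_bterm i b x :
  (bterm i b).[x] = binr i.+1 (x + i%:R) - binr i.+1 (x + i%:R - b%:R).
Proof.
by rewrite hornerD hornerN !horner_binp !(hornerD, hornerN) -!polyC_natr !hornerC hornerX.
Qed.

Lemma bterm_0 i : bterm i 0 = 0.
Proof. by rewrite /bterm subr0 subrr. Qed.

Lemma horner_bterm0 b x : (bterm 0 b).[x] = b%:R.
Proof.
by rewrite horner_bterm !binr1; ring.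
Qed.

(** The values of [binr] at [x + i - 1] cancel. This mirrors [lex_cocount_consS], where raising the
    head of [e] lowers the degree by 1. *)
Lemma horner_btermS i b x :
  (bterm i b.+1).[x] = (bterm i 1).[x] + (bterm i b).[x - 1].
Proof.
rewrite !horner_bterm -natr1.
have -> : x + i%:R - (b%:R + 1) = x - 1 + i%:R - b%:R by ring.
have -> : x + i%:R - 1%:R = x - 1 + i%:R by ring.
by ring.
Qed.

Lemma bterm_diff i b x :
  (bterm i.+1 b).[x] - (bterm i.+1 b).[x - 1] = (bterm i b).[x].
Proof.
rewrite !horner_bterm -natr1.
have -> : x + (i%:R + 1) = x + i%:R + 1 by ring.
have -> : x - 1 + (i%:R + 1) = x + i%:R by ring.
have -> : x + i%:R + 1 - b%:R = x + i%:R - b%:R + 1 by ring.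
by rewrite !binr_pascal; ring.
Qed.

Lemma horner_bterm1 i d : (bterm i 1).[d.+1%:R] = 'C(d + i, i)%:R.
Proof.
rewrite horner_bterm.
have -> : d.+1%:R + i%:R = (d + i)%:R + 1 :> rat by rewrite natrD -natr1; ring.
by rewrite addrK binr_pascal addrAC subrr add0r binr_nat.
Qed.

Lemma horner_sum_bterm1 k d :
  (\sum_(i < k) bterm i 1).[d.+1%:R] = (size (exponents k d.+1))%:R.
Proof.
rewrite horner_sum size_exponents_sum natr_sum.
by apply: eq_bigr => i _; rewrite horner_bterm1.
Qed.

Lemma eq_poly_large (p q : {poly rat}) N :
  (forall d, (N <= d)%N -> p.[d%:R] = q.[d%:R]) -> p = q.
Proof.
move=> h; apply/eqP; rewrite -subr_eq0; apply/eqP.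
apply: (@roots_geq_poly_eq0 _ _ [seq d%:R | d <- iota N (size (p - q))]).
- apply/allP => x /mapP[d]; rewrite mem_iota => /andP[le _] ->.
  by rewrite /root hornerD hornerN h // subrr.
- rewrite map_inj_uniq ?iota_uniq // => i j /eqP; rewrite eqr_nat; exact: eqP.
- by rewrite size_map size_iota.
Qed.

(** The backward difference kills the constant [bterm 0] and turns [bterm i.+1] into [bterm i], so
    induction settles all entries but the first, which evaluation at 0 then gives. *)
Lemma bterm_inj k (b c : nat -> nat) :
    \sum_(i < k) bterm i (b i) = \sum_(i < k) bterm i (c i) ->
  forall i, (i < k)%N -> b i = c i.
Proof.
elim: k b c => [|k IH] b c // E.
have ES : forall i, (i < k)%N -> b i.+1 = c i.+1.
  apply: (IH (b \o succn) (c \o succn)); apply: (@eq_poly_large _ _ 0) => d _.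
  have D u : (\sum_(i < k) bterm i ((u \o succn) i)).[d%:R] =
      (\sum_(i < k.+1) bterm i (u i)).[d%:R] - (\sum_(i < k.+1) bterm i (u i)).[d%:R - 1].
    rewrite !horner_sum !big_ord_recl /= !horner_bterm0 opprD addrACA subrr add0r.
    by rewrite -sumrB; apply: eq_bigr => i _; rewrite /bump /= add1n bterm_diff.
  by rewrite !D E.
have E0 : b 0%N = c 0%N.
  apply/eqP; rewrite -(eqr_nat rat) -(horner_bterm0 _ 0) -(horner_bterm0 (c 0%N) 0).
  move: E => /(congr1 (fun p => p.[0])); rewrite !horner_sum !big_ord_recl /=.
  rewrite (eq_bigr (fun i : 'I_k => (bterm i.+1 (c i.+1)).[0])); first by move/addIr => ->.
  by move=> i _; rewrite /bump /= add1n ES.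
by case.
Qed.

Lemma bterm_sum_widen k l (b : nat -> nat) : (k <= l)%N ->
  \sum_(i < k) bterm i (b i) = \sum_(i < l) bterm i (if (i < k)%N then b i else 0%N).
Proof.
move=> le; rewrite (big_ord_widen l (fun i => bterm i (b i)) le) big_mkcond /=.
by apply: eq_bigr => i _; case: ifP => //; rewrite bterm_0.
Qed.

(** By uniqueness, the b-sequence of [p] is [b] with [b 0] raised by [c]; as [b 0 = b 1], its first
    difference is [c]. *)
Lemma is_a0_uniq p a0 c k (b : nat -> nat) : is_a0 p a0 -> b 0%N = b 1%N ->
    (forall i, (k <= i)%N -> b i = 0%N) ->
  p = \sum_(i < k) bterm i (b i) + c%:R -> a0 = c.
Proof.
move=> [b' [_ _ pb'] ->] b01 bk pb.
set d := (size p).-1 in pb' *.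
(* Long enough for both sequences padded by zeros, and at least 2 so that entries 0 and 1 can be
   compared. *)
pose l := (maxn d.+1 k).+2.
have {}pb' : p = \sum_(i < d.+1) bterm i (b' i) by exact: pb'.
pose b1 i := if i == 0%N then (b 0 + c)%N else b i.
have pb1 : p = \sum_(i < l) bterm i (b1 i).
  have -> : p = \sum_(i < l) bterm i (b i) + c%:R.
    rewrite pb (@bterm_sum_widen k l b); last by rewrite /l; lia.
    congr (_ + _); apply: eq_bigr => i _; case: ltnP => // /bk -> //.
  rewrite !big_ord_recl /= addrAC; congr (_ + _).
  apply: (@eq_poly_large _ _ 0) => d' _.
  by rewrite hornerD !horner_bterm0 -polyC_natr hornerC -natrD.
have E i : (i < l)%N -> (if (i < d.+1)%N then b' i else 0%N) = b1 i.
  apply: (bterm_inj (b := fun i => if (i < d.+1)%N then b' i else 0%N)).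
  by rewrite -bterm_sum_widen -?pb' -?pb1 // /l; lia.
have l0 : (0 < l)%N by [].
have l1 : (1 < l)%N by [].
have := E _ l0; have := E _ l1; rewrite /b1 /= ltnS.
(* In degree 0, [a_0] is [b' 0] and the padded entry at 1 is 0, which forces [b 0 = b 1 = 0]. *)
rewrite /aseq; case: d {pb' l pb1 E l0 l1} => [|d] /=; lia.
Qed.

End BinomialPolynomials.

(** * Hilbert polynomial of a lexicographic prefix ideal *)

Section LexHilbertPolynomial.

(** The number of monomials of degree [d] in [k + 1] variables outside [lex_prefix_ideal e]. *)
Definition lex_cocount (e : seq nat) k d : nat :=
  count (fun s : seq nat => (take (size e) s < e)%O) (exponents k.+1 d).

Lemma lex_cocount_nil k d : lex_cocount [::] k d = 0%N.
Proof.
rewrite /lex_cocount (@eq_count _ _ pred0) ?count_pred0 // => s /=.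
by rewrite take0 ltxx.
Qed.

(** A vector below [0 :: e] starts with 0, and removing that entry compares the rest with [e]. *)
Lemma lex_cocount_cons0 e k d : lex_cocount (0%N :: e) k.+1 d = lex_cocount e k d.
Proof.
have h : count (fun s : seq nat => (take (size (0%N :: e)) s < 0%N :: e)%O)
    (map (cons 0%N) (exponents k.+1 d)) = lex_cocount e k d.
  by rewrite count_map; apply: eq_count => s /=; rewrite eqhead_ltxiE.
case: d h => [|d] h; rewrite {1}/lex_cocount; first by rewrite exponentsS0.
rewrite exponentsSS.
rewrite count_cat h count_map -[RHS]addn0; congr (_ + _)%N.
rewrite -[RHS](count_pred0 (exponents k.+2 d)); apply: eq_in_count => s.
by rewrite mem_exponents => /andP[/eqP]; case: s => // a s _ _ /=; rewrite ltxi_cons leEnat.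
Qed.

(** Either the first exponent is 0 and the rest is arbitrary, or it is positive and lowering it by 1
    lowers the bound [a.+1] to [a]. *)
Lemma lex_cocount_consS a e k d :
  lex_cocount (a.+1 :: e) k d.+1 = (size (exponents k d.+1) + lex_cocount (a :: e) k d)%N.
Proof.
rewrite /lex_cocount exponentsSS count_cat !count_map; congr (_ + _)%N.
apply: eq_in_count => s; rewrite mem_exponents => /andP[/eqP].
by case: s => // b s _ _ /=; rewrite !ltxi_cons !leEnat !ltnS.
Qed.

(** Induction on [e] and, inside it, on its head: a head 0 adds a zero entry to [b], and each
    increment of the head raises all entries of index below [k] by 1. *)
Lemma lex_cocount_poly e k : (size e <= k)%N ->
  exists b : nat -> nat, [/\ forall i, (k <= i)%N -> b i = 0%N,
    (size e < k)%N -> b 0%N = b 1%N &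
    exists N, forall d, (N <= d)%N ->
      (\sum_(i < k) bterm i (b i)).[d%:R] = (lex_cocount e k d)%:R].
Proof.
elim: e k => [|a e IHe] k.
  exists (fun=> 0%N); split=> //; exists 0%N => d _.
  by rewrite big1 ?horner0 ?lex_cocount_nil // => i _; rewrite bterm_0.
case: k => // k /= le; elim: a => [|a [b [b0 b01 [N NP]]]].
  have [b [b0 b01 [N NP]]] := IHe k le; exists b; split.
  - by move=> i lt; apply: b0; apply: ltnW.
  - by move=> lt; apply: b01.
  by exists N => d le_d; rewrite big_ord_recr /= b0 // bterm_0 addr0 lex_cocount_cons0 NP.
exists (fun i => if (i <= k)%N then (b i).+1 else 0%N); split.
- by move=> i lt; rewrite leqNgt lt.
(* Since [0 < k] here, the entries 0 and 1 are both raised and stay equal. *)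
- move=> lt; have k0 : (0 < k)%N by lia.
  by rewrite k0 /= b01.
exists N.+1 => -[//|d] le_d; rewrite lex_cocount_consS natrD -horner_sum_bterm1.
rewrite -NP // !horner_sum -big_split /=; apply: eq_bigr => i _.
have -> : (i <= k)%N by rewrite -ltnS.
by rewrite horner_btermS -natr1 addrK.
Qed.

End LexHilbertPolynomial.

(** * The saturated lexsegment ideal above an almost lexsegment ideal *)

Section LexEnvelope.
Variables (K : fieldType) (n : nat).
Implicit Types (I L : {mpoly K[n.+1]} -> Prop) (m : 'X_{1..n.+1}).

Lemma nonmembers_lex_prefix_ideal e d :
  nonmembers (lex_prefix_ideal (K := K) (n := n) e) d = lex_cocount e n d.
Proof.
rewrite /lex_cocount -count_lex_monomials; apply: eq_count => m.
rewrite ltNge; congr (~~ _); apply/asboolP/idP; by move/lex_prefix_idealX.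
Qed.

Lemma nonmembers_zero_ideal d :
  nonmembers (supp_ideal (K := K) (n := n.+1) (fun=> False)) d = size (exponents n.+1 d).
Proof.
rewrite -count_predT -count_lex_monomials; apply: eq_count => m /=.
by apply/negP => /asboolP/supp_idealX.
Qed.

Lemma hilbert_poly_uniq I p q : monomial_ideal I ->
  hilbert_poly I p -> hilbert_poly I q -> p = q.
Proof.
move=> mI /(hilbert_polyP p mI)[N NP] /(hilbert_polyP q mI)[M MP].
apply: (@eq_poly_large _ _ (maxn N M)) => d; rewrite geq_max => /andP[leN leM].
by rewrite NP // MP.
Qed.

(** For [I] nonzero, the prefix [e] has length [n - 1 < n], which yields [b 0 = b 1]. The zero ideal
    is its own [L]. *)
Lemma lex_envelope I : (0 < n)%N -> almost_lex I ->
  exists L, [/\ saturated L, lexsegment L,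
    exists c, lex_expansions c L I &
    exists b : nat -> nat, [/\ b 0%N = b 1%N, forall i, (n < i)%N -> b i = 0%N &
      hilbert_poly L (\sum_(i < n.+1) bterm i (b i))] ].
Proof.
move=> n0 alI; have /almost_lexP[mI cI lI] := alI.
case: (asboolP (exists m, I 'X_[m])) => [exI|nI].
  have [e [se IL LI]] := almost_lex_prefix n0 alI exI.
  have ltn : (size e < n)%N by rewrite se; lia.
  have sat : saturated (lex_prefix_ideal (K := K) (n := n) e).
    exact: lex_prefix_ideal_saturated (ltnW ltn).
  have lex : lexsegment (lex_prefix_ideal (K := K) (n := n) e).
    exact: lex_prefix_ideal_lexsegment.
  exists (lex_prefix_ideal (K := K) (n := n) e); split=> //.
    by apply: lex_expansions_exist => //; apply: saturated_lexsegment_almost_lex.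
  have [b [b0 b01 [N NP]]] := lex_cocount_poly (ltnW ltn).
  exists b; split; [exact: b01 | by move=> i lt; apply/b0/ltnW |].
  apply/hilbert_polyP; first exact: lex_prefix_ideal_monomial.
  exists N => d le_d; rewrite big_ord_recr /= b0 // bterm_0 addr0.
  by rewrite NP // nonmembers_lex_prefix_ideal.
exists (supp_ideal (fun=> False)); split.
- exact: zero_ideal_saturated.
- exact: zero_ideal_lexsegment.
- exists 0%N; apply: lex_expansions0; apply: eq_monomial_ideal => //.
    exact: supp_ideal_monomial.
  by move=> m; split=> [/supp_idealX //|Im]; case: nI; exists m.
(* The ring itself has [b_i = 1] for all [i <= n]. *)
exists (fun i => if (i <= n)%N then 1%N else 0%N); split.
- by rewrite n0.
- by move=> i; rewrite ltnNge => /negbTE ->.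
apply/hilbert_polyP; first exact: supp_ideal_monomial.
exists 1%N => -[//|d] _; rewrite nonmembers_zero_ideal -horner_sum_bterm1.
by rewrite !horner_sum; apply: eq_bigr => i _; rewrite -ltnS ltn_ord.
Qed.

End LexEnvelope.

(** * Equality of the two sets of ideals *)

Theorem mainTheorem3 (K : fieldType) (n : nat) (hn : (2 <= n)%N)
  (p : {poly rat}) (p_neq0 : p != 0)
  (hp : exists J : {mpoly K[n.+1]} -> Prop,
          homogeneous_ideal J /\ hilbert_poly J p)
  (a0 : nat) (ha0 : is_a0 p a0) :
  forall I : {mpoly K[n.+1]} -> Prop,
    obtained p a0 I <-> almost_lex I /\ hilbert_poly I p.
Proof.
move=> I; split=> [[L lexL ex]|[alI hI]].
  have [alL hL] : almost_lex L /\ hilbert_poly L (p - a0%:R).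
    move: lexL; rewrite /lex_ideal; case: eqP => [-> LE|_ [satL lL hL]]; last first.
      by split=> //; apply: saturated_lexsegment_almost_lex.
    (* For [p = a0] the expansions start from the whole ring, whose quotient is zero. *)
    have [wL hw] : almost_lex (@whole_ring K n) /\ hilbert_poly (@whole_ring K n) 0.
      split; first exact: whole_ring_almost_lex.
      have /almost_lexP[mw _ _] := @whole_ring_almost_lex K n.
      apply/hilbert_polyP => //; exists 0%N => d _; rewrite horner0.
      rewrite /nonmembers (@eq_count _ _ pred0) ?count_pred0 // => m /=.
      by apply/negbTE; rewrite negbK; apply/asboolP.
    have EL := eq_ideal_sym LE.
    by split; [apply: almost_lex_eq wL | apply: hilbert_poly_eq hw].
  by have := lex_expansionsP ex alL hL; rewrite subrK.
have n0 : (0 < n)%N by lia.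
have [L [satL lL [c ex] [b [b01 bn hL]]]] := lex_envelope n0 alI.
have alL := saturated_lexsegment_almost_lex satL lL.
have /almost_lexP[mL cL _] := alL; have /almost_lexP[mI _ _] := alI.
have [_ hI'] := lex_expansionsP ex alL hL.
have pE := hilbert_poly_uniq mI hI hI'.
have ac : a0 = c by apply: is_a0_uniq ha0 b01 bn pE.
have hL' : hilbert_poly L (p - a0%:R) by rewrite ac pE addrK.
exists L; last by rewrite ac.
rewrite /lex_ideal; case: eqP => [p0|_]; last by split.
(* With polynomial 0, [L] contains all monomials of some degree [N], in particular [x_n ^ N];
   cancelling [x_n] gives 1. *)
apply: eq_whole_ring => //; rewrite p0 in hL'.
have [N NP] := (hilbert_polyP 0 mL).1 hL'.
apply: (cancels_lastMn (c := N) cL); rewrite add0m.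
have := NP N (leqnn N); rewrite horner0 => /esym/eqP; rewrite pnatr_eq0.
rewrite -leqn0 leqNgt -has_count => /hasPn/(_ (U_(ord_max) *+ N)%MM).
rewrite mem_lex_monomials mdegMn mdeg1 mul1n eqxx negbK => /(_ isT).
by move/asboolP.
Qed.
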